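(* For all integers $n,R\ge 0$, $K^+(n,R)\le (n\log 2+1)\,\nu(n,R)$, where $$\nu(n,R)=\sum_{j=0}^n\frac{\binom{n}{j}}{\sum_{i=0}^R\binom{n-j}{i}}$$ and $\log$ is the natural logarithm.
   Context: $Q_n=\{0,1\}^n$ is ordered by $x\preceq y$ iff $x_i\le y_i$ for all $i$, and $d(x,y)$ is the Hamming distance. The downward directed ball is $B_n^-(x,R)=\{y\in Q_n: y\preceq x,\ d(x,y)\le R\}$. A set $\mathcal{C}\subseteq Q_n$ downward $R$-covers $Q_n$ if $Q_n=\bigcup_{c\in\mathcal{C}}B_n^-(c,R)$. $K^+(n,R)$ denotes the minimum size of a set $\mathcal{C}\subseteq Q_n$ that downward $R$-covers $Q_n$ (in particular $K^+(n,R)=1$ for $R\ge n$). The quantity $\sum_{i=0}^R\binom{n-j}{i}$ is the size of the upward directed ball $\{y\in Q_n: x\preceq y,\ d(x,y)\le R\}$ around any $x$ having exactly $j$ ones. *)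

(* Defs.v *)
From HB Require Import structures.
From mathcomp Require Import all_boot all_order all_algebra.
From mathcomp Require Import reals exp.

Set Implicit Arguments.
Unset Strict Implicit.
Unset Printing Implicit Defensive.

Import Order.TTheory GRing.Theory Num.Theory.

(* {0,1}^n, with [true] standing for 1. *)
Notation cube n := {ffun 'I_n -> bool}.

Definition cube_le n (x y : cube n) : bool := [forall i, x i ==> y i].

Definition hamming n (x y : cube n) : nat := #|[set i | x i != y i]|.

Definition down_ball n (x : cube n) (r : nat) : {set cube n} :=
  [set y | cube_le y x & hamming x y <= r].

Definition down_covers n (r : nat) (C : {set cube n}) : bool :=
  [set: cube n] == \bigcup_(c in C) down_ball c r.

Lemma down_covers_card_ex n r :
  exists m, [exists C : {set cube n}, down_covers r C && (#|C| == m)].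
Proof.
exists #|[set: cube n]|; apply/existsP; exists [set: cube n].
rewrite eqxx andbT /down_covers eqEsubset subsetT andbT; apply/subsetP => x _.
apply/bigcupP; exists x; rewrite ?inE //; apply/andP; split.
  by apply/forallP => i; apply/implyP.
rewrite /hamming (_ : [set i | _] = set0) ?cards0 //.
by apply/setP => i; rewrite !inE eqxx.
Qed.

Definition Kplus n r : nat := ex_minn (down_covers_card_ex n r).

Local Open Scope ring_scope.

(* The inner sum is the size of the upward directed ball of radius [r] around a
   point with [j] ones. It is at least 1 (its [i = 0] term), so no division by
   zero occurs, and [j <= n] makes [n - j] exact. *)
Definition nu (R : realType) (n r : nat) : R :=
  \sum_(0 <= j < n.+1)
    'C(n, j)%:R / (\sum_(0 <= i < r.+1) 'C(n - j, i))%N%:R.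

(* Main.v *)
(* Give every centre [c] the weight [1 / s c], where [s c] is the size of the
   upward ball around [c]. Since [s] decreases along the order, the centres
   above a point [x] have total weight at least [s x / s x = 1], so the weights
   form a fractional covering, of total weight [nu]. The greedy algorithm turns
   a fractional covering of weight [t] into a covering of [u] points by at most
   [(1 + ln u) t] sets; here [u = 2 ^ n]. *)
Require Import Defs.
From mathcomp Require Import all_boot all_order all_algebra.
From mathcomp Require Import reals exp ring lra.

Import Order.TTheory GRing.Theory Num.Theory.
Local Open Scope ring_scope.

Section FractionalCovering.

Context {R : realType} {S T : finType}.
Variables (A : S -> {set T}) (w : S -> R).
Hypothesis w_ge0 : forall c, 0 <= w c.
Hypothesis w_cover : forall x, 1 <= \sum_(c | x \in A c) w c.

Lemma fractional_cover_ge1 (x : T) : 1 <= \sum_c w c.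
Proof.
apply: le_trans (w_cover x) _; rewrite [leRHS](bigID (fun c => x \in A c)) /=.
by rewrite lerDl sumr_ge0.
Qed.

(** Averaging: summing over [y] in [U] the weight of the sets through [y], then exchanging the sums,
    gives [#|U| <= \sum_d w d * #|U :&: A d|]. A [c] with the largest intersection bounds every
    term. *)
Lemma fractional_cover_greedy (U : {set T}) : U != set0 ->
  exists c, #|U|%:R <= (\sum_c w c) * #|U :&: A c|%:R.
Proof.
case/set0Pn => x _.
(* With no sets at all, the covering condition at [x] would read [1 <= 0]. *)
have [c0 _|S0] := pickP {: S}; last first.
  by have := w_cover x; rewrite big_pred0 ?ler10 // => c; have := S0 c.
have [c _ cmax] := @arg_maxnP S c0 xpredT (fun c => #|U :&: A c|) isT.
exists c; apply: (@le_trans _ _ (\sum_(y in U) \sum_(d | y \in A d) w d)).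
  by rewrite -sum1_card natr_sum ler_sum.
rewrite (exchange_big_dep xpredT) //= mulr_suml ler_sum // => d _.
rewrite sumr_const -[leLHS]mulr_natr ler_wpM2l // ler_nat.
rewrite (eq_card (B := U :&: A d)); first exact: cmax.
by move=> y; rewrite !inE.
Qed.

(** Strong induction on [#|U|]. A greedy set removes at least a fraction [1 / tau] of the points, so
    [tau * ln #|U|] drops by at least 1, which pays for that set. *)
Lemma fractional_cover_integral (U : {set T}) : U != set0 ->
  exists2 C : {set S}, U \subset \bigcup_(c in C) A c
    & #|C|%:R <= (1 + ln #|U|%:R) * \sum_c w c.
Proof.
have [m] := ubnP #|U|; elim: m U => // m IHm U ltUm U0.
have /set0Pn [x _] := U0; have tau1 := fractional_cover_ge1 x.
have [c leUc] := fractional_cover_greedy U U0.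
set tau := \sum_c w c in IHm tau1 leUc *.
have tau0 : 0 < tau := lt_le_trans ltr01 tau1.
have u0 : 0 < #|U|%:R :> R by rewrite ltr0n card_gt0.
(* The last set leaves no point, so a drop of the logarithm cannot pay for it; the summand 1 does,
   since [1 <= tau]. *)
have [UDc0|UDc0] := eqVneq (U :\: A c) set0.
  exists [set c]; first by rewrite big_set1 -setD_eq0 UDc0.
  rewrite cards1; apply: le_trans tau1 _.
  by rewrite ler_peMl ?(ltW tau0) // lerDl ln_ge0 // ler1n card_gt0.
have t0 : (0 < #|U :&: A c|)%N.
  by rewrite lt0n; apply: contraTneq leUc => ->; rewrite mulr0 -ltNge.
have ltDU : (#|U :\: A c| < #|U|)%N.
  by rewrite -(cardsID (A c) U) -{1}[#|_|]add0n ltn_add2r.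
have [C UC leC] := IHm _ (leq_trans ltDU ltUm) UDc0.
exists (c |: C); first by rewrite bigcup_setU big_set1 -subDset.
have v0 : 0 < #|U :\: A c|%:R :> R by rewrite ltr0n card_gt0.
(* With [t = #|U :&: A c|] and [u = #|U|]: [ln (1 - t / u) <= - t / u <= - 1 / tau]. *)
have step : 1 <= (ln #|U|%:R - ln #|U :\: A c|%:R) * tau.
  rewrite -ler_pdivrMr // mul1r -opprB lerNr -ln_div ?posrE //.
  have -> : #|U :\: A c|%:R / #|U|%:R = 1 + - (#|U :&: A c|%:R / #|U|%:R) :> R.
    have uE : #|U|%:R = #|U :&: A c|%:R + #|U :\: A c|%:R :> R.
      by rewrite -natrD cardsID.
    by move: u0; rewrite uE => /lt0r_neq0 ?; field.
  apply: le_trans (le_ln1Dx _) _.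
    by rewrite ltrN2 ltr_pdivrMr // mul1r ltr_nat -(cardsID (A c) U)
      -{1}[#|_|]addn0 ltn_add2l card_gt0.
  by rewrite lerN2 ler_pdivlMr // mulrC ler_pdivrMr // mulrC.
rewrite (le_trans (y := 1 + #|C|%:R)) //.
  by rewrite nat1r ler_nat cardsU1 -add1n leq_add2r leq_b1.
by lra.
Qed.

End FractionalCovering.

Definition ones {n} (x : cube n) : {set 'I_n} := [set i | x i].

Lemma card_up_sphere n (x : cube n) k :
  #|[set c : cube n | cube_le x c & hamming c x == k]| = 'C(n - #|ones x|, k).
Proof.
(* [f D] flips the coordinates in [D]. It lies above [x] exactly when [D] avoids the ones of [x], so
   the sphere is the image of the [k]-subsets of the zeros of [x]. *)
pose f (D : {set 'I_n}) : cube n := [ffun i => x i (+) (i \in D)].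
have f_inj : injective f.
  move=> D E /ffunP fDE; apply/setP => i.
  by have := fDE i; rewrite !ffunE => /addbI.
have hammingf D : hamming (f D) x = #|D|.
  by apply: eq_card => i; rewrite !inE ffunE; case: (x i); case: (i \in D).
have -> : (n - #|ones x|)%N = #|~: ones x|.
  by rewrite [RHS]cardsCs setCK card_ord.
rewrite -cards_draws -(card_imset _ f_inj); apply: eq_card => c.
apply/idP/imsetP => [|[D]]; rewrite !inE.
  case/andP=> /forallP lexc; exists [set i | c i != x i]; last first.
    by apply/ffunP => i; rewrite ffunE inE; case: (x i); case: (c i).
  rewrite !inE; apply/andP; split=> //; apply/subsetP => i; rewrite !inE.
  by have := lexc i; case: (x i); case: (c i).
case/andP=> /subsetP Dx Dk ->; rewrite hammingf Dk andbT; apply/forallP => i.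
by rewrite ffunE; apply/implyP => xi; have := Dx i; rewrite !inE xi;
  case: (i \in D) => // /(_ isT).
Qed.

(** The level is the upward sphere of radius [j] around the zero vector. *)
Lemma card_level n j : #|[set c : cube n | #|ones c| == j]| = 'C(n, j).
Proof.
pose z : cube n := [ffun=> false].
have z0 : #|ones z| = 0%N by apply: eq_card0 => i; rewrite !inE ffunE.
have := card_up_sphere _ z j; rewrite z0 subn0 => <-; apply: eq_card => c; rewrite !inE.
have -> : hamming c z = #|ones c|.
  by apply: eq_card => i; rewrite !inE ffunE; case: (c i).
suff -> : cube_le z c by [].
by apply/forallP => i; rewrite ffunE.
Qed.

Definition up_ball_size n r j : nat := \sum_(0 <= i < r.+1) 'C(n - j, i).

Lemma card_up_ball n r (x : cube n) :
  #|[set c | x \in down_ball c r]| = up_ball_size n r #|ones x|.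
Proof.
(* The ball is split into spheres by distance; [inord] is faithful here because distances within the
   ball are at most [r]. *)
rewrite -sum1_card (partition_big (fun c => inord (hamming c x) : 'I_r.+1) xpredT) //=.
rewrite /up_ball_size big_mkord; apply: eq_bigr => k _.
rewrite sum1_card -card_up_sphere; apply: eq_card => c; rewrite !inE.
rewrite unfold_in /= !inE -andbA; congr (_ && _).
have [le_r|gt_r] /= := leqP (hamming c x) r; first by rewrite -val_eqE /= inordK.
by apply/esym/gtn_eqF; exact: leq_ltn_trans (leq_ord k) gt_r.
Qed.

Lemma up_ball_size_gt0 n r j : (0 < up_ball_size n r j)%N.
Proof. by rewrite /up_ball_size big_nat_recl // bin0. Qed.

Lemma leq_up_ball_size n r i j : (i <= j)%N ->
  (up_ball_size n r j <= up_ball_size n r i)%N.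
Proof. by move=> leij; apply: leq_sum => k _; rewrite leq_bin2l // leq_sub2l. Qed.

(** The weight is constant on each level, so grouping the centres by their number of ones gives [nu]
    term by term. *)
Lemma sum_inv_up_ball_size (R : realType) n r :
  \sum_(c : cube n) (up_ball_size n r #|ones c|)%:R^-1 = nu R n r.
Proof.
have lt_ones (c : cube n) : (#|ones c| < n.+1)%N.
  by rewrite ltnS -[leqRHS](card_ord n) max_card.
rewrite (partition_big (fun c => Ordinal (lt_ones c)) xpredT) //= /nu big_mkord.
apply: eq_bigr => j _; rewrite -card_level.
rewrite (eq_bigr (fun=> (up_ball_size n r j)%:R^-1)) => [|c /eqP <- //].
rewrite sumr_const mulr_natl; congr (_ *+ _).
by apply: eq_card => c; rewrite inE unfold_in.
Qed.

Lemma Kplus_le n r (C : {set cube n}) :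
  [set: cube n] \subset \bigcup_(c in C) down_ball c r -> (Kplus n r <= #|C|)%N.
Proof.
move=> covC; rewrite /Kplus; case: ex_minnP => k _; apply; apply/existsP.
by exists C; rewrite eqxx andbT /down_covers eqEsubset covC subsetT.
Qed.

Theorem proposition10 (R : realType) (n r : nat) :
  (Kplus n r)%:R <= (n%:R * ln 2 + 1) * nu R n r.
Proof.
pose w (c : cube n) : R := (up_ball_size n r #|ones c|)%:R^-1.
have w_cover x : 1 <= \sum_(c | x \in down_ball c r) w c.
  have s0 : (up_ball_size n r #|ones x|)%:R != 0 :> R.
    by rewrite pnatr_eq0 -lt0n up_ball_size_gt0.
  (* Write 1 as a sum of [1 / s x] over the [s x] centres covering [x], to be compared termwise with
     [w c]. *)
  rewrite -[leLHS](mulfV s0) -{1}card_up_ball mulr_natl -sumr_const.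
  rewrite big_mkcond [leRHS]big_mkcond ler_sum // => c _; rewrite !inE.
  case: ifP => // /andP[/forallP lexc _].
  rewrite lef_pV2 ?posrE ?ltr0n ?up_ball_size_gt0 // ler_nat.
  apply/leq_up_ball_size/subset_leq_card/subsetP => i.
  by rewrite !inE; apply/implyP.
have w_ge0 c : 0 <= w c by rewrite invr_ge0 ler0n.
have T0 : [set: cube n] != set0 by apply/set0Pn; exists [ffun=> false].
have [C covC leC] := fractional_cover_integral _ _ w_ge0 w_cover _ T0.
apply: le_trans (_ : #|C|%:R <= _); first by rewrite ler_nat Kplus_le.
apply: le_trans leC _; rewrite sum_inv_up_ball_size cardsT card_ffun card_bool.
by rewrite card_ord natrX lnXn // mulr_natl addrC.
Qed.
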